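(* Let $R$ be a commutative ring, let $L=\{x_1,\dots,x_n\}$ be a finite meet semilattice (with its elements enumerated in some way), let $k\ge2$ and let $\mathcal F:\mathfrak S_n^{k-2}\to R$ be any map. For each $x\in L$ fix an element $z_x\in L$ with $z_x\le x$ and a function $F_x:L\to R$, and put $f_x(z)=\sum_{y\le z}\mu(y,z)F_x(y)$. Consider the hypermatrix $M$ with entries $M_{i_1,\dots,i_k}=F_{x_{i_1}}(z_{x_{i_1}}\wedge x_{i_2}\wedge\cdots\wedge x_{i_k})$, $1\le i_1,\dots,i_k\le n$. Then \[ \mathrm{Det}_{\mathcal F}(M)=\begin{cases}\mathcal F(\mathrm{Id},\dots,\mathrm{Id})\displaystyle\prod_{x\in L}f_x(x)&\text{if } z_x=x \text{ for every } x\in L,\\[2mm] 0&\text{otherwise.}\end{cases} \]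
   Context: A meet semilattice is a poset in which every pair $x,y$ has a greatest lower bound $x\wedge y$. Its Möbius function $\mu$ is defined by $\mu(x,x)=1$, $\mu(x,y)=-\sum_{x\le z<y}\mu(z,y)$ if $x<y$, and $\mu(x,y)=0$ otherwise. $\mathfrak S_n$ is the symmetric group on $\{1,\dots,n\}$. For $\mathcal F:\mathfrak S_n^{k-2}\to R$ and a hypermatrix $M=(M_{i_1,\dots,i_k})_{1\le i_j\le n}$, the $\mathcal F$-determinant is $\mathrm{Det}_{\mathcal F}(M)=\sum_{(\sigma_2,\dots,\sigma_k)\in\mathfrak S_n^{k-1}}\mathrm{sign}(\sigma_2)\mathcal F(\sigma_3,\dots,\sigma_k)\prod_{i=1}^n M_{i,\sigma_2(i),\dots,\sigma_k(i)}$.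
   Formalization: The Möbius recurrence is taken as μ(x,y) = −Σ_{x≤z<y} μ(x,z), the standard one; the printed −Σ_{x≤z<y} μ(z,y) is circular and would force μ = 0 off the diagonal, making the formula false already for a two-element chain. *)

(* Defs.v *)
From mathcomp Require Import all_boot all_order all_algebra all_fingroup.

Set Implicit Arguments.
Unset Strict Implicit.
Unset Printing Implicit Defensive.

Import Order.TTheory GRing.Theory.
Local Open Scope ring_scope.

Section Mobius.
Context (d : Order.disp_t) (L : finPOrderType d).
Implicit Types x y z : L.

(* Recursion on fuel; the recursive calls are made at elements z < y, so any
   fuel exceeding the number of elements below y gives the same value.
   [mobiusE] below is the defining recurrence. *)
Fixpoint mobius_rec (m : nat) (x y : L) : int :=
  if m is m'.+1 then
    if x == y then 1
    else if (x < y)%O then - \sum_(z : L | (x <= z < y)%O) mobius_rec m' x z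
    else 0
  else 0.

Definition mobius (x y : L) : int := mobius_rec #|L|.+1 x y.

Let below y := #|[set z | (z < y)%O]|.

Lemma mobius_rec_fuel m1 m2 x y : (below y < m1)%N -> (below y < m2)%N ->
  mobius_rec m1 x y = mobius_rec m2 x y.
Proof.
elim: m1 m2 y => // m1 IH [//|m2] y lt1 lt2 /=.
case: eqP => // _; case: ifP => // _; congr (- _).
apply: eq_bigr => z /andP[_ lt_zy].
have lt_below : (below z < below y)%N.
  apply: proper_card; apply/properP; split.
    by apply/subsetP => t; rewrite !inE => /lt_trans; apply.
  by exists z; rewrite !inE ?ltxx.
by apply: IH; apply: leq_trans lt_below _.
Qed.

Lemma mobiusE x y :
  mobius x y =
    if x == y then 1
    else if (x < y)%O then - \sum_(z : L | (x <= z < y)%O) mobius x z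
    else 0.
Proof.
have below_lt z : (below z < #|L|)%N.
  rewrite -cardsT; apply: proper_card; rewrite properT.
  by apply/eqP => /setP/(_ z); rewrite !inE ltxx.
rewrite {1}/mobius /=; case: eqP => // _; case: ifP => // _; congr (- _).
apply: eq_bigr => z _; apply: mobius_rec_fuel; first exact: below_lt.
exact: ltnW (below_lt z).
Qed.

End Mobius.

(* A hypermatrix of order k and size n. *)
Definition hypermatrix (R : Type) (k n : nat) := k.-tuple 'I_n -> R.

(* The order is k = r + 2. The tuple s is (sigma_2, ..., sigma_k), so that
   [thead s] is sigma_2 and [behead s] is (sigma_3, ..., sigma_k). *)
Definition hyperdet (R : comPzRingType) (r n : nat)
    (F : r.-tuple 'S_n -> R) (M : hypermatrix R r.+2 n) : R :=
  \sum_(s : r.+1.-tuple 'S_n)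
     (-1) ^+ odd_perm (thead s) * F [tuple of behead s] *
     \prod_(i < n) M [tuple of i :: [seq (t : 'S_n) i | t <- s]].

Definition mobius_sum (R : pzRingType) (d : Order.disp_t)
    (L : finPOrderType d) (G : L -> R) (z : L) : R :=
  \sum_(y : L | (y <= z)%O) (mobius y z)%:~R * G y.

(* The iterated meet starts from [z (x i_1)], since L need not have a top. *)
Definition meet_hypermatrix (R : Type) (d : Order.disp_t)
    (L : finMeetSemilatticeType d) (r n : nat)
    (x : 'I_n -> L) (z : L -> L) (F : L -> L -> R) : hypermatrix R r.+2 n :=
  fun i => F (x (thead i))
    (\big[Order.meet/z (x (thead i))]_(j <- behead i) x j).

(* Main.v *)
(* Möbius inversion writes each entry of the hypermatrix as a sum of f_x(y)
   over the y below its meet. Expanding the product over the rows gives a sum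
   over choice functions g : {1, ..., n} -> L. If g is not injective, the sum
   over sigma_2 is a determinant with two equal rows. If g is injective, a
   nonzero term forces g(i) <= x_i for all i, hence g(i) = x_i since an
   injective decreasing self-map of a finite poset is the identity; then
   x_i <= z(x_i) and x_i <= x_{sigma_j(i)}, so z(x_i) = x_i and, by the same
   rigidity, every sigma_j is the identity. *)

Require Import Defs.
From mathcomp Require Import all_boot all_order all_algebra all_fingroup.

Set Implicit Arguments.
Unset Strict Implicit.
Unset Printing Implicit Defensive.

Import Order.TTheory GRing.Theory.
Local Open Scope ring_scope.

(** By finiteness, the orbit of [a] under the injective [p] returns to [a]. Hence [a] is an iterate
    of [p] applied to [p a], and iterates only decrease, which gives [a <= p a]. *)
Lemma inj_le_id (d : Order.disp_t) (L : finPOrderType d) (p : L -> L) :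
  injective p -> (forall a, (p a <= a)%O) -> p =1 id.
Proof.
move=> p_inj p_le a; apply/le_anti; rewrite p_le /=.
have iter_le m b : (iter m p b <= b)%O.
  by elim: m => //= m IHm; apply: le_trans (p_le _) IHm.
by rewrite -{1}(iter_order p_inj a) -orderSpred iterSr.
Qed.

Lemma sum_mobius_between (d : Order.disp_t) (L : finPOrderType d) (y z : L) :
  (y <= z)%O -> \sum_(w | (y <= w <= z)%O) mobius y w = (y == z)%:R.
Proof.
move=> le_yz; rewrite (bigD1 z) ?le_yz ?lexx //=.
rewrite (eq_bigl (fun w => (y <= w < z)%O)) => [|w]; last first.
  by rewrite lt_neqAle [(w != z) && _]andbC andbA.
rewrite mobiusE.
have [-> | neq_yz] := eqVneq y z.
  by rewrite big1 ?addr0 // => w /andP[/le_lt_trans H /H]; rewrite ltxx.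
by rewrite lt_neqAle neq_yz le_yz /= addNr.
Qed.

(** Möbius inversion: after exchanging the sums, the coefficient of [G w] is the sum of $\mu(w,y)$
    over $w \le y \le z$, a Kronecker delta. *)
Lemma sum_mobius_sum (R : pzRingType) (d : Order.disp_t)
    (L : finPOrderType d) (G : L -> R) (z : L) :
  \sum_(y | (y <= z)%O) mobius_sum G y = G z.
Proof.
rewrite /mobius_sum.
rewrite (exchange_big_dep (fun w => w <= z)%O) /=; last first.
  by move=> y w le_yz /le_trans; apply.
transitivity (\sum_(w | (w <= z)%O) (w == z)%:R * G w).
  apply: eq_bigr => w le_wz; rewrite -mulr_suml -rmorph_sum /=.
  rewrite (eq_bigl (fun y => w <= y <= z)%O) => [|y]; last by rewrite andbC.
  by rewrite sum_mobius_between // natz; case: eqP.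
rewrite (bigD1 z) //= eqxx mul1r big1 ?addr0 // => w /andP[_ /negPf->].
by rewrite mul0r.
Qed.

Lemma le_bigmeet (d : Order.disp_t) (L : meetSemilatticeType d) (I : Type)
    (s : seq I) (x : I -> L) (a y : L) :
  (y <= \big[Order.meet/a]_(j <- s) x j)%O
    = (y <= a)%O && all (fun j => y <= x j)%O s.
Proof.
elim: s => [|j s IHs]; first by rewrite big_nil andbT.
by rewrite big_cons lexI IHs /= andbCA.
Qed.

Lemma prod_natr_bool (R : comPzRingType) (I : finType) (b : I -> bool) :
  \prod_i (b i)%:R = [forall i, b i]%:R :> R.
Proof.
case: (boolP [forall i, b i]) => [/forallP b_all | /forallPn[i /negPf b_i]].
  by rewrite big1 // => i _; rewrite b_all.
by rewrite (bigD1 i) //= b_i mul0r.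
Qed.

(** The sign involves only $\sigma_2$ and [calF] only the other permutations, so the sum factors,
    and its $\sigma_2$ part is the Leibniz formula for [\det A]. *)
Lemma hyperdet_row_product (R : comPzRingType) (r n : nat)
    (calF : r.-tuple 'S_n -> R) (A : 'M[R]_n) (B : r.-tuple 'S_n -> R) :
  \sum_(s : r.+1.-tuple 'S_n)
     (-1) ^+ odd_perm (thead s) * calF [tuple of behead s] *
     ((\prod_i A i (thead s i)) * B [tuple of behead s])
  = \det A * \sum_t calF t * B t.
Proof.
rewrite (reindex (fun p : 'S_n * r.-tuple 'S_n => [tuple of p.1 :: p.2])) /=.
  rewrite -(pair_bigA _ (fun (u : 'S_n) (t : r.-tuple 'S_n) =>
    (-1) ^+ odd_perm (thead [tuple of u :: t])
      * calF [tuple of behead [tuple of u :: t]]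
      * ((\prod_i A i (thead [tuple of u :: t] i))
      * B [tuple of behead [tuple of u :: t]]))) /=.
  rewrite /determinant mulr_suml; apply: eq_bigr => u _.
  rewrite mulr_sumr; apply: eq_bigr => t _.
  have -> : [tuple of behead [tuple of u :: t]] = t by apply: val_inj.
  by rewrite theadE mulrACA.
exists (fun s => (thead s, [tuple of behead s])) => [[u t] _ | s _] /=.
  by rewrite theadE; congr pair; apply: val_inj.
by rewrite [RHS]tuple_eta.
Qed.

Lemma all_behead_cons (T : Type) (m : nat) (a : pred T) (s : m.+1.-tuple T) :
  all a s = a (thead s) && all a (behead s).
Proof. by rewrite [in LHS](tuple_eta s). Qed.

(** The range of summation is moved into a 0/1 weight, so that [y] runs over all of [L] in every row
    and the product over the rows can be distributed. *)
Lemma meet_hypermatrixE (R : pzRingType) (d : Order.disp_t)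
    (L : finMeetSemilatticeType d) (n : nat) (x : 'I_n -> L) (r : nat)
    (z : L -> L) (F : L -> L -> R) (s : r.+1.-tuple 'S_n) (i : 'I_n) :
  meet_hypermatrix x z F [tuple of i :: [seq (t : 'S_n) i | t <- s]] =
    \sum_y ((y <= z (x i))%O && all (fun t : 'S_n => y <= x (t i))%O s)%:R
             * mobius_sum (F (x i)) y.
Proof.
rewrite /meet_hypermatrix theadE /= -sum_mobius_sum big_mkcond /=.
apply: eq_bigr => y _; rewrite le_bigmeet all_map /=.
by case: (_ && _); rewrite ?mul1r ?mul0r.
Qed.

Section ChoiceTerm.
Context (R : comPzRingType) (d : Order.disp_t) (L : finMeetSemilatticeType d).
Context (n : nat) (x : 'I_n -> L) (x_bij : bijective x).
Context (r : nat) (calF : r.-tuple 'S_n -> R).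
Context (z : L -> L) (z_le : forall a : L, (z a <= a)%O).

(** Taking a sequence of any length allows its use both for all of $\sigma_2,\dots,\sigma_k$ and for
    $\sigma_3,\dots,\sigma_k$ alone. *)
Definition choice_below (g : 'I_n -> L) (s : seq 'S_n) :=
  [forall i, (g i <= z (x i))%O && all (fun t : 'S_n => g i <= x (t i))%O s].

(** The coefficient of $\prod_i f_{x_i}(g(i))$ in the expanded hyperdeterminant. *)
Definition choice_sum (g : 'I_n -> L) :=
  \sum_(s : r.+1.-tuple 'S_n)
     (-1) ^+ odd_perm (thead s) * calF [tuple of behead s]
       * (choice_below g s)%:R.

Lemma choice_sum_noninj (g : 'I_n -> L) : ~~ injectiveb g -> choice_sum g = 0.
Proof.
case/injectivePn => i1 [i2 neq_i eq_g].
(* The conditions on $\sigma_2$ are the entries of [A] at $(i, \sigma_2(i))$; those on [z] and the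
   other permutations form [choice_below g t]. Rows [i1] and [i2] of [A] agree. *)
pose A := (\matrix_(i, j) (g i <= x j)%O%:R : 'M[R]_n).
transitivity (\det A * \sum_(t : r.-tuple 'S_n)
                 calF t * (choice_below g t)%:R).
  rewrite -hyperdet_row_product; apply: eq_bigr => s _; congr (_ * _).
  rewrite -!prod_natr_bool -big_split /=; apply: eq_bigr => i _.
  by rewrite mxE -natrM mulnb all_behead_cons andbCA.
by rewrite (determinant_alternate neq_i) ?mul0r // => j; rewrite !mxE eq_g.
Qed.

Lemma choice_below_rigid (g : 'I_n -> L) (s : seq 'S_n) :
  injective g -> choice_below g s ->
  [/\ g =1 x, forall a, z a = a & forall t, t \in s -> t = 1%g].
Proof.
move=> g_inj /forallP/= g_le; case: (x_bij) => x' xK x'K.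
have x'_inj : injective x' by apply: can_inj x'K.
have gx : g =1 x.
  (* Rigidity concerns self-maps of [L], so [g] is precomposed with the inverse [x'] of the
     enumeration. *)
  move=> i; rewrite -[i in LHS]xK.
  apply: (@inj_le_id _ _ (g \o x')) => [|a]; first exact: inj_comp.
  by have /andP[/le_trans-> //] := g_le (x' a); rewrite x'K.
split=> // [a|t t_s].
  apply/le_anti; rewrite z_le /=.
  by have /andP[] := g_le (x' a); rewrite gx x'K.
apply/permP => i; rewrite perm1.
(* With [g = x] the bound reads [x i <= x (t i)]: carried over to [L], [t] is increasing, so it is
   its inverse that is decreasing and to which rigidity applies. *)
have: t^-1%g =1 id.
  move=> j; apply: (bij_inj x_bij).
  pose p := x \o t^-1%g \o x'.
  have p_id : p =1 id.
    apply: inj_le_id => [|a]; first apply: inj_comp x'_inj.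
      by apply: inj_comp (bij_inj x_bij) perm_inj.
    have /andP[_ /allP/(_ _ t_s)] := g_le (t^-1%g (x' a)).
    by rewrite gx permKV x'K.
  by rewrite -[RHS]p_id /p /= xK.
by move=> tV_id; rewrite -[LHS]tV_id permK.
Qed.

Lemma choice_sum_neq (g : 'I_n -> L) : ~ g =1 x -> choice_sum g = 0.
Proof.
move=> neq_gx; have [/injectiveP g_inj | ] := boolP (injectiveb g); last first.
  exact: choice_sum_noninj.
apply: big1 => s _; case: (boolP (choice_below g s)) => [|_].
  by case/(choice_below_rigid g_inj).
by rewrite mulr0.
Qed.

Lemma choice_sum_eq :
  choice_sum x = if [forall a : L, z a == a] then calF [tuple of nseq r 1%g]
                 else 0.
Proof.
case: ifP => [/forallP z_id | /forallP z_nid]; last first.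
  apply: big1 => s _.
  case: (boolP (choice_below x s)) => [|_]; last by rewrite mulr0.
  case/(choice_below_rigid (bij_inj x_bij)) => _ z_id.
  by case: z_nid => a; apply/eqP.
rewrite /choice_sum (bigD1 [tuple of nseq r.+1 1%g]) //= big1 ?addr0 => [|s].
  have -> : thead [tuple of nseq r.+1 (1%g : 'S_n)] = 1%g by [].
  rewrite odd_perm1 expr0 mul1r.
  have -> : choice_below x (nseq r.+1 1%g).
    apply/forallP => i; rewrite (eqP (z_id _)) lexx andTb.
    by apply/allP => t /nseqP[-> _]; rewrite perm1.
  by rewrite mulr1; congr calF; apply: val_inj.
case: (boolP (choice_below x s)) => [|_]; last by rewrite mulr0.
case/(choice_below_rigid (bij_inj x_bij)) => _ _ s_id /eqP[]; apply: val_inj.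
(* The constant list is given the length [size s], the form that [all_pred1P] expects. *)
rewrite /= -[_ :: _]/(nseq r.+1 _) -[X in nseq X](size_tuple s).
by apply/all_pred1P/allP => t /s_id->/=.
Qed.

Lemma hyperdet_choice (F : L -> L -> R) :
  hyperdet calF (meet_hypermatrix x z F) =
    \sum_(g : {ffun 'I_n -> L})
       choice_sum g * \prod_i mobius_sum (F (x i)) (g i).
Proof.
rewrite /hyperdet /choice_sum.
under [RHS]eq_bigr do rewrite mulr_suml.
rewrite exchange_big /=; apply: eq_bigr => s _.
under eq_bigr do rewrite meet_hypermatrixE.
rewrite bigA_distr_bigA mulr_sumr; apply: eq_bigr => g _.
by rewrite big_split /= prod_natr_bool mulrA.
Qed.

End ChoiceTerm.

Theorem theorem2 (R : comPzRingType) (d : Order.disp_t)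
    (L : finMeetSemilatticeType d) (n : nat)
    (x : 'I_n -> L) (x_bij : bijective x)
    (r : nat) (calF : r.-tuple 'S_n -> R)
    (z : L -> L) (z_le : forall a : L, (z a <= a)%O)
    (F : L -> L -> R) :
  hyperdet calF (meet_hypermatrix x z F) =
    if [forall a : L, z a == a]
    then calF [tuple of nseq r 1%g] * \prod_(a : L) mobius_sum (F a) a
    else 0.
Proof.
rewrite hyperdet_choice (bigD1 [ffun i => x i]) //=.
rewrite [X in _ + X]big1 => [|g neq_g].
  (* The finite function and [x] agree only pointwise, so the coefficients are compared term by
     term. *)
  have -> : choice_sum x calF z [ffun i => x i] = choice_sum x calF z x.
    apply: eq_bigr => s _; congr (_ * _%:R); congr nat_of_bool.
    by apply: eq_forallb => i; rewrite ffunE.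
  rewrite addr0 (choice_sum_eq x_bij _ z_le).
  case: ifP => _; last by rewrite mul0r.
  rewrite [in RHS](reindex x) /=; last exact: onW_bij.
  by congr (_ * _); apply: eq_bigr => i _; rewrite ffunE.
rewrite (choice_sum_neq x_bij _ z_le) ?mul0r // => gx; case/eqP: neq_g.
by apply/ffunP => i; rewrite ffunE gx.
Qed.
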